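(* Let $R$ be an associative (not necessarily commutative) ring with identity, and let $k\ge 1$ be a natural number which is a unit in $R$. Then the abelian group $\mathrm{NK}_1(R)$ has no $k$-torsion; that is, if $x\in \mathrm{NK}_1(R)$ satisfies $x^k=1$ (group written multiplicatively), then $x=1$.
   Context: For an associative ring $A$ with identity, $\mathrm{GL}_n(A)$ is embedded in $\mathrm{GL}_{n+1}(A)$ via $\alpha\mapsto \begin{pmatrix}\alpha&0\\0&1\end{pmatrix}$, $\mathrm{GL}(A)=\bigcup_n \mathrm{GL}_n(A)$, $\mathrm{E}_n(A)$ is the subgroup of $\mathrm{GL}_n(A)$ generated by the elementary matrices $I+\lambda e_{ij}$ ($\lambda\in A$, $i\neq j$), and $\mathrm{E}(A)=\bigcup_n \mathrm{E}_n(A)$. The Whitehead group is the abelian group $\mathrm{K}_1(A)=\mathrm{GL}(A)/\mathrm{E}(A)$. $R[X]$ is the polynomial ring in one variable $X$ commuting with the elements of $R$. $\mathrm{NK}_1(R)=\ker\big(\mathrm{K}_1(R[X])\to \mathrm{K}_1(R)\big)$, the map being induced by $X\mapsto 0$. The statement that $k$ is a unit in $R$ means that $k\cdot 1_R$ is invertible in $R$. *)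

(* Defs.v *)
From HB Require Import structures.
From mathcomp Require Import all_boot all_order all_algebra.
From mathcomp Require Import boolp classical_sets.

Set Implicit Arguments.
Unset Strict Implicit.
Unset Printing Implicit Defensive.

Import GRing.Theory.
Local Open Scope ring_scope.
Local Open Scope quotient_scope.
Local Open Scope classical_set_scope.

Section GeneratedSubgroup.
Variable G : groupType.

Inductive gen (S : set G) : set G :=
| gen_in x : S x -> gen S x
| gen1 : gen S 1%g
| genM x y : gen S x -> gen S y -> gen S (x * y)%g
| genV x : gen S x -> gen S x^-1%g.

End GeneratedSubgroup.

(* An element of GL_n(A) is stored with its (two-sided, hence unique) inverse,
   so that no invertibility test on the noncommutative ring A is needed. *)
Section GLn.
Variables (A : pzRingType) (n : nat).

Definition inverse_pair (p : 'M[A]_n * 'M[A]_n) :=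
  (p.1 *m p.2 == 1%:M) && (p.2 *m p.1 == 1%:M).

Record GLn := MkGLn { glpair : 'M[A]_n * 'M[A]_n; _ : inverse_pair glpair }.

HB.instance Definition _ := [isSub for glpair].
HB.instance Definition _ := [Choice of GLn by <:].

Definition glmx (x : GLn) : 'M[A]_n := (glpair x).1.

Definition mkGL (M N : 'M[A]_n) (MN : M *m N = 1%:M) (NM : N *m M = 1%:M) :
  GLn := @MkGLn (M, N) (introT andP (conj (introT eqP MN) (introT eqP NM))).

Lemma glmxV x : glmx x *m (glpair x).2 = 1%:M.
Proof. by case: x => p pP; case/andP: (pP) => /eqP. Qed.

Lemma glVmx x : (glpair x).2 *m glmx x = 1%:M.
Proof. by case: x => p pP; case/andP: (pP) => _ /eqP. Qed.

Lemma glmx_inj : injective glmx.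
Proof.
move=> x y exy; apply: val_inj => /=.
have e2 : (glpair x).2 = (glpair y).2.
  by rewrite -[LHS]mulmx1 -(glmxV y) mulmxA -exy glVmx mul1mx.
by rewrite [LHS]surjective_pairing [RHS]surjective_pairing e2; congr pair.
Qed.

Fact glmul_subproof x y :
  inverse_pair (glmx x *m glmx y, (glpair y).2 *m (glpair x).2).
Proof.
apply/andP; split; apply/eqP => /=.
  by rewrite mulmxA -[_ *m _ *m (glpair y).2]mulmxA glmxV mulmx1 glmxV.
by rewrite mulmxA -[_ *m _ *m glmx x]mulmxA glVmx mulmx1 glVmx.
Qed.

Definition glone : GLn := mkGL (mulmx1 1%:M) (mulmx1 1%:M).
Definition glmul x y : GLn := MkGLn (glmul_subproof x y).
Definition glinv x : GLn := mkGL (glVmx x) (glmxV x).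

Fact glmulA : associative glmul.
Proof. by move=> x y z; apply: glmx_inj; rewrite /glmx /= mulmxA. Qed.
Fact glmul1 : left_id glone glmul.
Proof. by move=> x; apply: glmx_inj; rewrite /glmx /= mul1mx. Qed.
Fact glmulr1 : right_id glone glmul.
Proof. by move=> x; apply: glmx_inj; rewrite /glmx /= mulmx1. Qed.
Fact glmulV : left_inverse glone glinv glmul.
Proof. by move=> x; apply: glmx_inj; exact: glVmx. Qed.
Fact glmulrV : right_inverse glone glinv glmul.
Proof. by move=> x; apply: glmx_inj; exact: glmxV. Qed.

HB.instance Definition _ :=
  isGroup.Build GLn glmulA glmul1 glmulr1 glmulV glmulrV.

Lemma glmxM (x y : GLn) : glmx (x * y)%g = glmx x *m glmx y.
Proof. by []. Qed.
Lemma glmx1 : glmx 1%g = 1%:M.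
Proof. by []. Qed.

Definition elementary : set GLn :=
  [set x | exists (i j : 'I_n) (a : A),
     i != j /\ glmx x = 1%:M + a *: delta_mx i j].

Definition En : set GLn := gen elementary.

End GLn.
Arguments En : clear implicits.

Section Stabilization.
Variable A : pzRingType.

(* The infinite matrix diag(M, 1, 1, ...). *)
Definition stab n (M : 'M[A]_n) (i j : nat) : A :=
  match insub i : option 'I_n, insub j : option 'I_n with
  | Some i', Some j' => M i' j'
  | _, _ => (i == j)%:R
  end.

Definition resize n N (M : 'M[A]_n) : 'M[A]_N := \matrix_(i, j) stab M i j.

Lemma resizeE n k (M : 'M[A]_n) : resize (n + k) M = block_mx M 0 0 1%:M.
Proof.
apply/matrixP => i j; rewrite mxE /stab.
case: (split_ordP i) => i' ->; case: (split_ordP j) => j' ->;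
  rewrite ?block_mxEul ?block_mxEur ?block_mxEdl ?block_mxEdr ?mxE /=.
- by rewrite !valK.
- rewrite valK insubF; last by rewrite ltnNge leq_addr.
  by rewrite ltn_eqF // (leq_trans (ltn_ord _)) ?leq_addr.
- rewrite insubF; last by rewrite ltnNge leq_addr.
  by rewrite gtn_eqF // (leq_trans (ltn_ord _)) ?leq_addr.
- rewrite insubF; last by rewrite ltnNge leq_addr.
  by rewrite eqn_add2l.
Qed.

Lemma resizeM n N (M M' : 'M[A]_n) : (n <= N)%N ->
  resize N (M *m M') = resize N M *m resize N M'.
Proof.
move=> /subnKC <-; rewrite !resizeE mulmx_block.
by rewrite !mul0mx !mulmx0 !mul1mx addr0 !add0r.
Qed.

Lemma resize1 n N : (n <= N)%N -> resize N (1%:M : 'M[A]_n) = 1%:M.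
Proof. by move=> /subnKC <-; rewrite resizeE -scalar_mx_block. Qed.

Lemma stab_resize n N (M : 'M[A]_n) : (n <= N)%N -> stab (resize N M) = stab M.
Proof.
move=> nN; apply/funext => i; apply/funext => j; rewrite {1}/stab.
case: insubP => [i' _ <-|]; first case: insubP => [j' _ <-|].
- by rewrite mxE.
- rewrite -leqNgt => jN; rewrite /stab [insub j]insubF; last first.
    by rewrite ltnNge (leq_trans nN jN).
  by case: insubP.
- rewrite -leqNgt => iN; rewrite /stab insubF //.
  by rewrite ltnNge (leq_trans nN iN).
Qed.

Lemma stab_inj n : injective (@stab n).
Proof.
move=> M N e; apply/matrixP => i j.
by have := congr1 (fun g : nat -> nat -> A => g i j) e; rewrite /stab !valK.
Qed.

Definition GLresize n N (h : (n <= N)%N) (x : GLn A n) : GLn A N.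
Proof.
refine (@mkGL _ _ (resize N (glmx x)) (resize N (glpair x).2) _ _).
- by rewrite -resizeM // glmxV resize1.
- by rewrite -resizeM // glVmx resize1.
Defined.

Lemma GLresizeM n N (h : (n <= N)%N) (x y : GLn A n) :
  GLresize h (x * y)%g = (GLresize h x * GLresize h y)%g.
Proof. by apply: glmx_inj; rewrite glmxM -resizeM. Qed.

Lemma GLresize1 n N (h : (n <= N)%N) : GLresize h (1%g : GLn A n) = 1%g.
Proof. by apply: glmx_inj; exact: resize1. Qed.

Lemma GLresizeV n N (h : (n <= N)%N) (x : GLn A n) :
  GLresize h x^-1%g = (GLresize h x)^-1%g.
Proof.
by apply: (@mulgI _ (GLresize h x)); rewrite -GLresizeM !mulgV GLresize1.
Qed.

Lemma En_resize n N (h : (n <= N)%N) (x : GLn A n) :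
  En A n x -> En A N (GLresize h x).
Proof.
elim=> {x} [x [i [j [a [ij xE]]]]||x y _ IHx _ IHy|x _ IHx].
- apply: gen_in; exists (widen_ord h i), (widen_ord h j), a; split=> //.
  apply/matrixP => u v; rewrite mxE xE !mxE /stab.
  case: insubP => [u' _ eu|]; first case: insubP => [v' _ ev|].
  + by rewrite !mxE -!val_eqE /= eu ev.
  + rewrite -leqNgt => nv; rewrite (_ : (v == _) = false).
      by rewrite andbF mulr0 addr0.
    by apply/negbTE; rewrite -val_eqE /= gtn_eqF // (leq_trans _ nv).
  + rewrite -leqNgt => nu; rewrite (_ : (u == widen_ord _ _) = false).
      by rewrite mulr0 addr0.
    by apply/negbTE; rewrite -val_eqE /= gtn_eqF // (leq_trans _ nu).
- by rewrite GLresize1; exact: gen1.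
- by rewrite GLresizeM; exact: genM.
- by rewrite GLresizeV; exact: genV.
Qed.

End Stabilization.

(* GL(A) is the union of the GL_n(A): matrices of various sizes are identified
   when they stabilize to the same infinite matrix. *)
Section GL.
Variable A : pzRingType.

Definition preGL := {n : nat & GLn A n}.
HB.instance Definition _ := Choice.on preGL.

Definition pstab (x : preGL) : nat -> nat -> A := stab (glmx (tagged x)).

Definition same_stab : rel preGL := fun x y => `[< pstab x = pstab y >].

Fact same_stab_equiv : equiv_class_of same_stab.
Proof.
split=> [x|x y|y x z].
- exact/asboolP.
- by apply/asboolP/asboolP => ->.
- by move=> /asboolP e1 /asboolP e2; apply/asboolP; rewrite e1.
Qed.

Canonical same_stab_equiv_rel := EquivRelPack same_stab_equiv.

Definition GL := {eq_quot same_stab}.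
HB.instance Definition _ := Choice.on GL.
HB.instance Definition _ := EqQuotient.on GL.

Definition inGL n (x : GLn A n) : GL := \pi_GL (Tagged (GLn A) x).

Lemma inGL_eq m n (x : GLn A m) (y : GLn A n) :
  inGL x = inGL y <-> stab (glmx x) = stab (glmx y).
Proof.
split=> [/eqmodP /asboolP //|e]; apply/eqmodP; exact/asboolP.
Qed.

Lemma inGL_inj n : injective (@inGL n).
Proof. by move=> x y /inGL_eq /stab_inj /glmx_inj. Qed.

Lemma inGL_resize n N (h : (n <= N)%N) (x : GLn A n) :
  inGL (GLresize h x) = inGL x.
Proof. by apply/inGL_eq; exact: stab_resize. Qed.

Lemma inGL_repr (q : GL) : inGL (tagged (repr q)) = q.
Proof. by rewrite /inGL -[RHS]reprK; case: (repr q). Qed.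

Definition GLone : GL := inGL (1%g : GLn A 0).
Definition GLmul (p q : GL) : GL :=
  inGL (GLresize (leq_addr (tag (repr q)) (tag (repr p))) (tagged (repr p)) *
        GLresize (leq_addl (tag (repr p)) (tag (repr q))) (tagged (repr q)))%g.
Definition GLinv (p : GL) : GL := inGL (tagged (repr p))^-1%g.

Lemma inGL_resize_eq m n N (hm : (m <= N)%N) (hn : (n <= N)%N)
    (x : GLn A m) (y : GLn A n) :
  inGL x = inGL y -> GLresize hm x = GLresize hn y.
Proof. by move=> e; apply: inGL_inj; rewrite !inGL_resize. Qed.

Lemma inGL1 n : inGL (1%g : GLn A n) = GLone.
Proof. by rewrite -(GLresize1 _ (leq0n n)) inGL_resize. Qed.

Lemma inGLM n (x y : GLn A n) : inGL (x * y)%g = GLmul (inGL x) (inGL y).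
Proof.
rewrite /GLmul; set p := repr (inGL x); set q := repr (inGL y).
have hn := leq_addr (tag p + tag q) n.
have hpq := leq_addl n (tag p + tag q).
rewrite -(inGL_resize hn) -[RHS](inGL_resize hpq) !GLresizeM.
congr (inGL (_ * _)%g); apply: inGL_resize_eq; rewrite inGL_resize inGL_repr //.
Qed.

Lemma inGLV n (x : GLn A n) : inGL x^-1%g = GLinv (inGL x).
Proof.
rewrite /GLinv; set p := repr (inGL x).
have hn := leq_addr (tag p) n; have hp := leq_addl n (tag p).
rewrite -(inGL_resize hn) -[RHS](inGL_resize hp) !GLresizeV.
by congr (inGL (_^-1)%g); apply: inGL_resize_eq; rewrite inGL_repr.
Qed.

Lemma GL_ind1 (P : GL -> Prop) : (forall n (x : GLn A n), P (inGL x)) ->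
  forall p, P p.
Proof. by move=> h p; rewrite -(inGL_repr p). Qed.

Lemma GL_ind2 (P : GL -> GL -> Prop) :
  (forall n (x y : GLn A n), P (inGL x) (inGL y)) -> forall p q, P p q.
Proof.
move=> h p q; elim/GL_ind1: p => m x; elim/GL_ind1: q => n y.
by rewrite -(inGL_resize (leq_addr n m) x) -(inGL_resize (leq_addl m n) y).
Qed.

Fact GLmulA : associative GLmul.
Proof.
move=> p q r; elim/GL_ind1: p => m x; move: q r; apply: GL_ind2 => n y z.
rewrite -(inGL_resize (leq_addr n m) x) -(inGL_resize (leq_addl m n) y).
by rewrite -(inGL_resize (leq_addl m n) z) -!inGLM mulgA.
Qed.
Fact GLmul1 : left_id GLone GLmul.
Proof. by elim/GL_ind1=> n x; rewrite -(inGL1 n) -inGLM mul1g. Qed.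
Fact GLmulr1 : right_id GLone GLmul.
Proof. by elim/GL_ind1=> n x; rewrite -(inGL1 n) -inGLM mulg1. Qed.
Fact GLmulV : left_inverse GLone GLinv GLmul.
Proof. by elim/GL_ind1=> n x; rewrite -inGLV -inGLM mulVg inGL1. Qed.
Fact GLmulrV : right_inverse GLone GLinv GLmul.
Proof. by elim/GL_ind1=> n x; rewrite -inGLV -inGLM mulgV inGL1. Qed.

HB.instance Definition _ :=
  isGroup.Build GL GLmulA GLmul1 GLmulr1 GLmulV GLmulrV.

Definition E : set GL := [set p | exists n (x : GLn A n), En A n x /\ p = inGL x].

Lemma E1 : E 1%g.
Proof. by exists 0, 1%g; split; first exact: gen1. Qed.

Lemma EM p q : E p -> E q -> E (p * q)%g.
Proof.
move=> [m [x [Ex ->]]] [n [y [Ey ->]]].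
rewrite -(inGL_resize (leq_addr n m) x) -(inGL_resize (leq_addl m n) y).
eexists _, _; split; last by rewrite -[LHS]inGLM.
by apply: genM; apply: En_resize.
Qed.

Lemma EV p : E p -> E p^-1%g.
Proof.
by move=> [m [x [Ex ->]]]; exists m, x^-1%g; split; [exact: genV|rewrite inGLV].
Qed.

End GL.

(* Whitehead's lemma, in the form [GL(A), GL(A)] <= E(A). *)
Section Whitehead.
Variable A : pzRingType.

Section Blocks.
Variable n : nat.
Implicit Types a b : 'M[A]_n.

Let upM a b : block_mx 1%:M a 0 1%:M *m block_mx 1%:M b 0 1%:M
            = block_mx 1%:M (a + b) 0 1%:M :> 'M[A]_(n + n).
Proof. by rewrite mulmx_block !mul0mx !mulmx0 !mul1mx !mulmx1 !addr0 add0r addrC. Qed.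

Let lowM a b : block_mx 1%:M 0 a 1%:M *m block_mx 1%:M 0 b 1%:M
            = block_mx 1%:M 0 (a + b) 1%:M :> 'M[A]_(n + n).
Proof. by rewrite mulmx_block !mul0mx !mulmx0 !mul1mx !mulmx1 !addr0 !add0r. Qed.

Definition up a : GLn A (n + n).
Proof.
refine (@mkGL _ _ (block_mx 1%:M a 0 1%:M) (block_mx 1%:M (- a) 0 1%:M) _ _).
  by rewrite upM subrr -scalar_mx_block.
by rewrite upM addNr -scalar_mx_block.
Defined.

Definition low a : GLn A (n + n).
Proof.
refine (@mkGL _ _ (block_mx 1%:M 0 a 1%:M) (block_mx 1%:M 0 (- a) 1%:M) _ _).
  by rewrite lowM subrr -scalar_mx_block.
by rewrite lowM addNr -scalar_mx_block.
Defined.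

Lemma En_up a : En A (n + n) (up a).
Proof.
have up0 : up 0 = 1%g by apply: glmx_inj; rewrite /glmx /= -scalar_mx_block.
have upD b c : up (b + c) = (up b * up c)%g.
  by apply: glmx_inj; rewrite glmxM; exact: esym (upM b c).
rewrite (matrix_sum_delta a).
apply: (big_ind (fun b => En A (n + n) (up b))) => [|b c|i _].
- by rewrite up0; exact: gen1.
- by rewrite upD; exact: genM.
apply: (big_ind (fun b => En A (n + n) (up b))) => [|b c|j _].
- by rewrite up0; exact: gen1.
- by rewrite upD; exact: genM.
apply: gen_in; exists (lshift n i), (rshift n j), (a i j); split.
  by rewrite eq_lrshift.
rewrite /glmx /= scalar_mx_block -[delta_mx (lshift _ _) _]submxK scale_block_mx.
rewrite add_block_mx; congr block_mx; apply/matrixP => u v;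
  by rewrite !mxE ?eq_lshift ?eq_rshift ?eq_lrshift ?eq_rlshift ?andbF
       ?mulr0 ?addr0 ?add0r.
Qed.

Lemma En_low a : En A (n + n) (low a).
Proof.
have low0 : low 0 = 1%g by apply: glmx_inj; rewrite /glmx /= -scalar_mx_block.
have lowD b c : low (b + c) = (low b * low c)%g.
  by apply: glmx_inj; rewrite glmxM; exact: esym (lowM b c).
rewrite (matrix_sum_delta a).
apply: (big_ind (fun b => En A (n + n) (low b))) => [|b c|i _].
- by rewrite low0; exact: gen1.
- by rewrite lowD; exact: genM.
apply: (big_ind (fun b => En A (n + n) (low b))) => [|b c|j _].
- by rewrite low0; exact: gen1.
- by rewrite lowD; exact: genM.
apply: gen_in; exists (rshift n i), (lshift n j), (a i j); split.
  by rewrite eq_rlshift.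
rewrite /glmx /= scalar_mx_block -[delta_mx (rshift _ _) _]submxK scale_block_mx.
rewrite add_block_mx; congr block_mx; apply/matrixP => u v;
  by rewrite !mxE ?eq_lshift ?eq_rshift ?eq_lrshift ?eq_rlshift ?andbF
       ?mulr0 ?addr0 ?add0r.
Qed.

Definition whi a b : GLn A (n + n) := (up a * low (- b) * up a)%g.

Lemma glmx_whi a b : a *m b = 1%:M -> b *m a = 1%:M ->
  glmx (whi a b) = block_mx 0 a (- b) 0.
Proof.
move=> ab ba; rewrite /whi !glmxM /glmx /= !mulmx_block.
rewrite !mul0mx !mulmx0 !mul1mx !mulmx1 ?addr0 ?add0r mulmxN ab subrr.
by rewrite mulNmx ba mul0mx add0r addNr.
Qed.

Definition dd (x : GLn A n) : GLn A (n + n) :=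
  (whi (glmx x) (glmx x^-1) * whi (- 1%:M) (- 1%:M))%g.

Lemma En_dd x : En A (n + n) (dd x).
Proof. by do !apply: genM; first [exact: En_up | exact: En_low]. Qed.

Lemma glmx_dd x : glmx (dd x) = block_mx (glmx x) 0 0 (glmx x^-1%g).
Proof.
rewrite glmxM glmx_whi -?glmxM ?mulgV ?mulVg //.
rewrite glmx_whi ?mulmxN ?mulNmx ?mulmx1 ?opprK // mulmx_block.
by rewrite !mul0mx !mulmx0 !mulmxN !mulmx1 !opprK ?addr0 ?add0r.
Qed.

End Blocks.

Lemma E_commg (p q : GL A) : E [~ p, q]%g.
Proof.
move: p q; apply: GL_ind2 => n x y.
exists (n + n)%N, (dd x^-1 * dd y^-1 * dd (x * y))%g; split.
  by apply: genM; [apply: genM|]; exact: En_dd.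
have -> : [~ inGL x, inGL y]%g = inGL [~ x, y]%g.
  by rewrite /commg /conjg !inGLM !inGLV.
apply/inGL_eq; rewrite -(stab_resize _ (leq_addr n n)) resizeE; congr stab.
rewrite 2!glmxM !glmx_dd !mulmx_block !mul0mx !mulmx0 ?addr0 ?add0r -!glmxM.
congr block_mx; rewrite ?mul0mx //; first by rewrite /commg /conjg !mulgA.
by rewrite !invgK mulgV.
Qed.

End Whitehead.

Section K1.
Variable A : pzRingType.

Definition coset_rel : rel (GL A) := fun p q => `[< E (p^-1 * q)%g >].

Fact coset_rel_equiv : equiv_class_of coset_rel.
Proof.
have sym p q : coset_rel p q -> coset_rel q p.
  by move=> /asboolP /EV; rewrite invgM invgK => h; apply/asboolP.
split=> [p|p q|q p r].
- by apply/asboolP; rewrite mulVg; exact: E1.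
- by apply/idP/idP => /sym.
- move=> /asboolP e1 /asboolP e2; apply/asboolP.
  by have := EM e1 e2; rewrite mulgA mulgK.
Qed.

Canonical coset_rel_equiv_rel := EquivRelPack coset_rel_equiv.

Definition K1 := {eq_quot coset_rel}.
HB.instance Definition _ := Choice.on K1.
HB.instance Definition _ := EqQuotient.on K1.

Definition inK1 (p : GL A) : K1 := \pi_K1 p.

Lemma inK1_eq p q : inK1 p = inK1 q <-> E (p^-1 * q)%g.
Proof. by split=> [/eqmodP /asboolP //|e]; apply/eqmodP/asboolP. Qed.

Lemma inK1_repr (x : K1) : inK1 (repr x) = x.
Proof. exact: reprK. Qed.

Lemma K1_ind1 (P : K1 -> Prop) : (forall p, P (inK1 p)) -> forall x, P x.
Proof. by move=> h x; rewrite -(inK1_repr x). Qed.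

Definition K1one : K1 := inK1 1%g.
Definition K1mul (x y : K1) : K1 := inK1 (repr x * repr y)%g.
Definition K1inv (x : K1) : K1 := inK1 (repr x)^-1%g.

Lemma E_conjg (p q : GL A) : E p -> E (p ^ q)%g.
Proof. by move=> Ep; rewrite -[(p ^ q)%g](mulVKg p); apply: EM => //; exact: E_commg. Qed.

Lemma inK1M p q : inK1 (p * q)%g = K1mul (inK1 p) (inK1 q).
Proof.
apply/inK1_eq; set p' := repr _; set q' := repr _.
have ep : E (p^-1 * p')%g by apply/inK1_eq; rewrite inK1_repr.
have eq : E (q^-1 * q')%g by apply/inK1_eq; rewrite inK1_repr.
have := EM (E_conjg q ep) eq; rewrite /conjg invgM.
by rewrite !mulgA mulgK.
Qed.

Lemma inK1V p : inK1 p^-1%g = K1inv (inK1 p).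
Proof.
apply/inK1_eq; set p' := repr _.
have ep : E (p'^-1 * p)%g by apply/inK1_eq; rewrite inK1_repr.
by have := E_conjg p^-1%g ep; rewrite /conjg invgK !mulgA mulgK.
Qed.

Fact K1mulA : associative K1mul.
Proof.
by elim/K1_ind1=> p; elim/K1_ind1=> q; elim/K1_ind1=> r; rewrite -!inK1M mulgA.
Qed.
Fact K1mul1 : left_id K1one K1mul.
Proof. by elim/K1_ind1=> p; rewrite -inK1M mul1g. Qed.
Fact K1mulr1 : right_id K1one K1mul.
Proof. by elim/K1_ind1=> p; rewrite -inK1M mulg1. Qed.
Fact K1mulV : left_inverse K1one K1inv K1mul.
Proof. by elim/K1_ind1=> p; rewrite -inK1V -inK1M mulVg. Qed.
Fact K1mulrV : right_inverse K1one K1inv K1mul.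
Proof. by elim/K1_ind1=> p; rewrite -inK1V -inK1M mulgV. Qed.

HB.instance Definition _ :=
  isGroup.Build K1 K1mulA K1mul1 K1mulr1 K1mulV K1mulrV.

Lemma K1_mulgC (x y : K1) : (x * y = y * x)%g.
Proof.
elim/K1_ind1: x => p; elim/K1_ind1: y => q; rewrite -[LHS]inK1M -[RHS]inK1M.
by apply/inK1_eq; have := E_commg q p; rewrite /commg /conjg invgM !mulgA.
Qed.

End K1.

Section Functoriality.
Variables (A B : pzRingType) (f : {rmorphism A -> B}).

Definition GLn_map n (x : GLn A n) : GLn B n.
Proof.
refine (@mkGL _ _ (map_mx f (glmx x)) (map_mx f (glpair x).2) _ _).
- by rewrite -map_mxM glmxV map_mx1.
- by rewrite -map_mxM glVmx map_mx1.
Defined.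

Lemma GLn_mapM n (x y : GLn A n) :
  GLn_map (x * y)%g = (GLn_map x * GLn_map y)%g.
Proof. by apply: glmx_inj; rewrite /glmx /= map_mxM. Qed.

Lemma GLn_map1 n : GLn_map (1%g : GLn A n) = 1%g.
Proof. by apply: glmx_inj; rewrite /glmx /= map_mx1. Qed.

Lemma GLn_mapV n (x : GLn A n) : GLn_map x^-1%g = (GLn_map x)^-1%g.
Proof. exact: glmx_inj. Qed.

Lemma En_map n (x : GLn A n) : En A n x -> En B n (GLn_map x).
Proof.
elim=> {x} [x [i [j [a [ij xE]]]]||x y _ IHx _ IHy|x _ IHx].
- apply: gen_in; exists i, j, (f a); split=> //.
  by rewrite /glmx /= xE map_mxD map_mx1 map_mxZ map_delta_mx.
- by rewrite GLn_map1; exact: gen1.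
- by rewrite GLn_mapM; exact: genM.
- by rewrite GLn_mapV; exact: genV.
Qed.

Lemma stab_map n (M : 'M[A]_n) i j : stab (map_mx f M) i j = f (stab M i j).
Proof.
rewrite /stab; case: insub => [i'|]; last by rewrite rmorph_nat.
by case: insub => [j'|]; rewrite ?mxE ?rmorph_nat.
Qed.

Definition GL_map (p : GL A) : GL B := inGL (GLn_map (tagged (repr p))).

Lemma GL_mapE n (x : GLn A n) : GL_map (inGL x) = inGL (GLn_map x).
Proof.
apply/inGL_eq; apply/funext => i; apply/funext => j; rewrite !stab_map.
by have /inGL_eq -> := inGL_repr (inGL x).
Qed.

Lemma GL_mapM p q : GL_map (p * q)%g = (GL_map p * GL_map q)%g.
Proof.
move: p q; apply: GL_ind2 => n x y.
by rewrite -[(inGL x * _)%g]inGLM !GL_mapE GLn_mapM inGLM.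
Qed.

Lemma GL_mapV p : GL_map p^-1%g = (GL_map p)^-1%g.
Proof.
elim/GL_ind1: p => n x.
by rewrite -[((inGL x)^-1)%g]inGLV !GL_mapE GLn_mapV inGLV.
Qed.

Lemma E_map p : E p -> E (GL_map p).
Proof.
move=> [n [x [Ex ->]]]; rewrite GL_mapE.
by exists n, (GLn_map x); split=> //; exact: En_map.
Qed.

Definition K1_map (x : K1 A) : K1 B := inK1 (GL_map (repr x)).

Lemma K1_mapE p : K1_map (inK1 p) = inK1 (GL_map p).
Proof.
by apply/inK1_eq; rewrite -GL_mapV -GL_mapM; apply: E_map; apply/inK1_eq/inK1_repr.
Qed.

Fact K1_mapF : {morph K1_map : x y / (x / y)%g}.
Proof.
elim/K1_ind1=> p; elim/K1_ind1=> q.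
rewrite -[((inK1 q)^-1)%g]inK1V -[(inK1 p * _)%g]inK1M !K1_mapE.
by rewrite GL_mapM GL_mapV inK1M inK1V.
Qed.

HB.instance Definition _ := isGroupMorphism.Build (K1 A) (K1 B) K1_map K1_mapF.

End Functoriality.

Section NK1.
Variable R : nzRingType.

Definition ev0 (p : {poly R}) : R := p.[0].

Fact ev0_zmod : zmod_morphism ev0.
Proof. by move=> p q; rewrite /ev0 !hornerE. Qed.
Fact ev0_monoid : GRing.monoid_morphism ev0.
Proof.
split=> [|p q]; first by rewrite /ev0 hornerC.
by rewrite /ev0 !horner_coef0 coef0M.
Qed.

HB.instance Definition _ :=
  GRing.isZmodMorphism.Build {poly R} R ev0 ev0_zmod.
HB.instance Definition _ :=
  GRing.isMonoidMorphism.Build {poly R} R ev0 ev0_monoid.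

Definition NK1_pred : pred (K1 {poly R}) := fun x => K1_map ev0 x == 1%g.

Fact NK1_group_closed : group_closed NK1_pred.
Proof.
split=> [|x y]; rewrite ?unfold_in /NK1_pred ?gmulf1 // => /eqP ex /eqP ey.
by rewrite gmulfF /= ex ey mulgV.
Qed.

Record NK1 := MkNK1 { nk1val :> K1 {poly R}; _ : NK1_pred nk1val }.

HB.instance Definition _ := [isSub for nk1val].
HB.instance Definition _ := [Choice of NK1 by <:].
HB.instance Definition _ :=
  SubChoice_isSubGroup.Build (K1 {poly R}) NK1_pred NK1 NK1_group_closed.

Lemma NK1_mulgC (x y : NK1) : (x * y = y * x)%g.
Proof. by apply: val_inj; rewrite !gmulfM K1_mulgC. Qed.

End NK1.

(* Main.v *)
(* By Higman's trick a class in NK_1(R) is represented by 1 - NX with N nilpotent.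
   Suppose that its k-th power is trivial.  For a central in R and m >= 1, the
   ring morphism R[X] -> M_m(R[X]) sending X to a matrix C with C^m = a X^m
   induces an endomorphism of K_1(R[X]) (a transfer followed by a Verschiebung)
   which sends [1 - NX] to [1 - a N^m X^m]; hence the latter is killed by k too.
   When 1/k is available, every 1 - c (NX)^m - ... is the product of
   (1 - (c/k) (NX)^m)^k, whose class is trivial, and of a polynomial in NX of the
   form 1 + O((NX)^(m+1)).  As NX is nilpotent, descending induction on m shows
   that all such classes are trivial, in particular [1 - NX]. *)
Require Import Defs.
From mathcomp Require Import all_boot all_order all_algebra.
From mathcomp Require Import ring zify.
Set Implicit Arguments.
Unset Strict Implicit.
Unset Printing Implicit Defensive.
Import GRing.Theory.
Local Open Scope ring_scope.

(** * Elementary matrices with block support *)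

Section Elementary.
Variables (A : pzRingType) (n : nat).

(* A support from rows in [Q] to columns outside [Q] makes all products of such
   matrices vanish, so that M |-> 1 + M is additive-to-multiplicative. *)
Lemma En_support (Q : pred 'I_n) (M : 'M[A]_n) :
  (forall r c, ~~ (Q r && ~~ Q c) -> M r c = 0) ->
  exists2 x : GLn A n, En A n x & glmx x = 1%:M + M.
Proof.
pose supp (M : 'M[A]_n) := forall r c, ~~ (Q r && ~~ Q c) -> M r c = 0.
pose good M := supp M /\ exists2 x : GLn A n, En A n x & glmx x = 1%:M + M.
move=> sM; suff [] : good M by [].
have good0 : good 0.
  split=> [r c _|]; first by rewrite mxE.
  by exists 1%g; [exact: gen1 | rewrite addr0].
have goodD (M1 M2 : 'M[A]_n) : good M1 -> good M2 -> good (M1 + M2).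
  move=> [s1 [x1 E1 e1]] [s2 [x2 E2 e2]]; split.
    by move=> r c h; rewrite mxE s1 ?s2 ?addr0.
  exists (x1 * x2)%g; first exact: genM.
  rewrite glmxM e1 e2 mulmxDl mul1mx mulmxDr mulmx1.
  suff -> : M1 *m M2 = 0 by rewrite addr0 addrAC addrA.
  apply/matrixP => r c; rewrite !mxE big1 // => j _.
  case Qj: (Q j); first by rewrite s1 ?mul0r // Qj andbF.
  by rewrite s2 ?mulr0 // Qj.
rewrite (matrix_sum_delta M).
apply: (big_ind good) => // r _; apply: (big_ind good) => // c _.
have [/andP[Qr Qc]|h] := boolP (Q r && ~~ Q c); last first.
  by rewrite sM // scale0r.
have rc : r != c by apply: contraNneq Qc => <-.
split=> [i j|].
  rewrite !mxE; case: eqP => [->|] //=; last by rewrite mulr0.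
  by case: eqP => [->|]; rewrite ?mulr0 // Qr Qc.
have DD (a b : A) : (1%:M + a *: delta_mx r c) *m (1%:M + b *: delta_mx r c)
    = 1%:M + (a + b) *: delta_mx r c :> 'M[A]_n.
  rewrite mulmxDl mul1mx mulmxDr mulmx1 scalerDl.
  suff -> : (a *: delta_mx r c) *m (b *: delta_mx r c) = 0 :> 'M[A]_n.
    by rewrite addr0 addrAC addrA.
  apply/matrixP => i j; rewrite !mxE big1 // => l _; rewrite !mxE.
  have [->|] := eqVneq l c; last by rewrite andbF mulr0 mul0r.
  by rewrite [c == r]eq_sym (negPf rc) !mulr0.
have h1 : (1%:M + M r c *: delta_mx r c) *m (1%:M - M r c *: delta_mx r c) = 1%:M :> 'M[A]_n.
  by rewrite -scaleNr DD subrr scale0r addr0.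
have h2 : (1%:M - M r c *: delta_mx r c) *m (1%:M + M r c *: delta_mx r c) = 1%:M :> 'M[A]_n.
  by rewrite -scaleNr DD addNr scale0r addr0.
exists (mkGL h1 h2) => //; apply: gen_in; exists r, c, (M r c); split=> //.
Qed.

End Elementary.

(** * Matrices over a matrix ring as block matrices *)

Section Flatten.
Variables (A : pzRingType) (m n : nat).

Fact bidx_subproof (u : 'I_m) (i : 'I_n.+1) : (u * n.+1 + i < m * n.+1)%N.
Proof. have := ltn_ord u; have := ltn_ord i; nia. Qed.
(** The block index is the high digit, so block (0, 0) is the upper left corner, where stabilization
    also places a matrix. *)
Definition bidx u i := Ordinal (bidx_subproof u i).

Fact bquo_subproof (k : 'I_(m * n.+1)) : (k %/ n.+1 < m)%N.
Proof. by rewrite ltn_divLR. Qed.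
Definition bquo k := Ordinal (bquo_subproof k).
Definition brem (k : 'I_(m * n.+1)) : 'I_n.+1 := Ordinal (ltn_pmod k (ltn0Sn n)).

Lemma bidxK k : bidx (bquo k) (brem k) = k.
Proof. by apply: val_inj; rewrite /= -divn_eq. Qed.
Lemma bquoK u i : bquo (bidx u i) = u.
Proof. by apply: val_inj; rewrite /= divnMDl // divn_small ?addn0. Qed.
Lemma bremK u i : brem (bidx u i) = i.
Proof. by apply: val_inj; rewrite /= modnMDl modn_small. Qed.

Lemma bidx_ind (P : 'I_(m * n.+1) -> Prop) :
  (forall u i, P (bidx u i)) -> forall k, P k.
Proof. by move=> h k; rewrite -(bidxK k). Qed.

Definition flat (M : 'M['M[A]_n.+1]_m) : 'M[A]_(m * n.+1) :=
  \matrix_(k, l) M (bquo k) (bquo l) (brem k) (brem l).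

Lemma flatE M u i v j : flat M (bidx u i) (bidx v j) = M u v i j.
Proof. by rewrite mxE !bquoK !bremK. Qed.

Lemma flatM M N : flat (M *m N) = flat M *m flat N.
Proof.
apply/matrixP; elim/bidx_ind => u i; elim/bidx_ind => v j.
rewrite flatE !mxE summxE.
rewrite (reindex (fun p : 'I_m * 'I_n.+1 => bidx p.1 p.2)) /=; last first.
  exists (fun k => (bquo k, brem k)) => [[w l]|k] _ /=.
    by rewrite bquoK bremK.
  exact: bidxK.
rewrite -(pair_bigA _ (fun w l => flat M (bidx u i) (bidx w l) * flat N (bidx w l) (bidx v j))).
apply: eq_bigr => w _; rewrite mxE; apply: eq_bigr => l _.
by rewrite !flatE.
Qed.

Lemma flatD M N : flat (M + N) = flat M + flat N.
Proof. by apply/matrixP => k l; rewrite !mxE. Qed.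

Lemma flat1 : flat 1%:M = 1%:M.
Proof.
apply/matrixP; elim/bidx_ind => u i; elim/bidx_ind => v j.
rewrite flatE !mxE; have [->|uv] := eqVneq u v.
  rewrite mxE; congr (_%:R); congr nat_of_bool.
  by apply/eqP/eqP => [->|/(congr1 brem)]; rewrite ?bremK.
rewrite mxE; case: eqP => // /(congr1 bquo); rewrite !bquoK => e.
by rewrite e eqxx in uv.
Qed.

Lemma En_flat (Q : pred 'I_m) (M : 'M['M[A]_n.+1]_m) :
  (forall u v, ~~ (Q u && ~~ Q v) -> M u v = 0) ->
  exists2 x : GLn A (m * n.+1), En A _ x & glmx x = flat (1%:M + M).
Proof.
move=> h; have [|x Ex xE] := @En_support A _ (Q \o bquo) (flat M).
  elim/bidx_ind => u i; elim/bidx_ind => v j /=; rewrite !bquoK flatE => uv.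
  by rewrite h // mxE.
by exists x; rewrite // flatD flat1.
Qed.

End Flatten.

(** * Transfer along X |-> C *)

Section CompanionFactorization.
Variables (B : pzRingType) (m : nat) (b c : B).
Hypothesis bc : GRing.comm b c.

(* At b = 'X this is a matrix C with C^(m+1) = c X^(m+1). *)
Definition companion : 'M[B]_m.+1 := \matrix_(u, v)
  ((u.+1 == v :> nat)%:R * b + ((u == m :> nat) && (v == 0 :> nat))%:R * (c * b)).

(** The predicate allows the superdiagonal to be split off one row at a time. *)
Definition shift (p : pred nat) : 'M[B]_m.+1 :=
  \matrix_(u, v) ((p u && (u.+1 == v :> nat))%:R * b).

Definition corner : 'M[B]_m.+1 :=
  \matrix_(u, v) (((u == 0 :> nat) && (v == 0 :> nat))%:R * (c * b ^+ m.+1)).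

Definition column (p : pred nat) : 'M[B]_m.+1 :=
  \matrix_(u, v) ((p u && (v == 0 :> nat))%:R * (c * b ^+ (m.+1 - u))).

Lemma shift_mul (p : pred nat) (N : 'M[B]_m.+1) u v :
  (shift p *m N) u v =
  if insub u.+1 is Some w then (p u)%:R * (b * N w v) else 0.
Proof.
rewrite mxE; case: insubP => [w _ ew|]; last first.
  rewrite -leqNgt => h; rewrite big1 // => w _.
  rewrite mxE gtn_eqF ?andbF ?mul0r //; exact: leq_trans (ltn_ord _) h.
rewrite (bigD1 w) //= mxE ew eqxx andbT mulrA big1 ?addr0 // => w' hw.
by rewrite mxE -ew val_eqE eq_sym (negPf hw) andbF !mul0r.
Qed.

(** Peels off row t. A single row has a support fit for [En_flat], which the whole superdiagonal in
    general has not. The cross term vanishes because row t + 1 of the second shift is zero. *)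
Lemma shiftS t : 1%:M - shift (ltn^~ t.+1) =
  (1%:M - shift (pred1 t)) *m (1%:M - shift (ltn^~ t)).
Proof.
rewrite mulmxBl mul1mx mulmxBr mulmx1.
have -> : shift (pred1 t) *m shift (ltn^~ t) = 0.
  apply/matrixP => u v; rewrite shift_mul mxE; case: insubP => // w _ /= ew.
  rewrite mxE ew; case: eqP => [->|]; last by rewrite mul0r.
  by rewrite ltnNge leqnSn /= mul0r !mulr0.
rewrite subr0 -addrA -opprD; congr (_ - _); apply/matrixP => u v.
rewrite !mxE /= -mulrDl -natrD ltnS leq_eqVlt /=; congr (_ * _); congr (_%:R).
by case: ltngtP => _; case: (_.+1 == _).
Qed.

Lemma corner_column :
  (1%:M - corner) *m (1%:M - column (leq 1)) = 1%:M - column predT.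
Proof.
rewrite mulmxBl mul1mx mulmxBr mulmx1.
have -> : corner *m column (leq 1) = 0.
  apply/matrixP => u v; rewrite !mxE big1 // => w _; rewrite !mxE.
  by case: (w : nat) => [|w'] /=; rewrite ?andbF ?mul0r ?mulr0.
rewrite subr0 -addrA -opprD; congr (_ - _); apply/matrixP => u v.
rewrite !mxE /=; case: (nat_of_ord u) => [|u'] /=; rewrite ?subn0 ?mul0r.
  by rewrite add0r.
by rewrite addr0.
Qed.

(** The shift moves [column predT] up one row and multiplies it by b. As b and c commute, this
    reproduces its entries except c b in the last row, which is the entry of [companion] off the
    superdiagonal. *)
Lemma companion_factorization :
  (1%:M - shift (ltn^~ m)) *m (1%:M - corner) *m (1%:M - column (leq 1))
  = 1%:M - companion.
Proof.
rewrite -mulmxA corner_column mulmxBl mul1mx mulmxBr mulmx1.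
have -> : shift (ltn^~ m) *m column predT =
    column predT - \matrix_(u, v) (((u == m :> nat) && (v == 0 :> nat))%:R * (c * b)).
  apply/matrixP => u v; rewrite shift_mul !mxE /=; case: insubP => [w uw ew|].
    rewrite ltnS in uw; rewrite mxE uw (ltn_eqF uw) /= mul0r subr0 mul1r !mulr_natl mulrnAr.
    by rewrite mulrA bc -mulrA -exprS ew subSS -subSn // ltnW.
  rewrite -leqNgt ltnS => mu; have -> : u = m :> nat.
    by apply/eqP; rewrite eqn_leq mu -ltnS ltn_ord.
  by rewrite eqxx subSnn expr1 subrr.
have -> : companion = shift (ltn^~ m) +
    \matrix_(u, v) (((u == m :> nat) && (v == 0 :> nat))%:R * (c * b)).
  apply/matrixP => u v; rewrite !mxE /=.
  case: ltnP => // mu; have -> : u = m :> nat.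
    by apply/eqP; rewrite eqn_leq mu -ltnS ltn_ord.
  by rewrite gtn_eqF.
by rewrite opprB -!addrA addKr -opprD [X in _ - X]addrC.
Qed.

End CompanionFactorization.

Section MatrixRepresentation.
Variables (A B : pzRingType) (m n : nat) (f : {rmorphism A -> 'M[B]_m}).

(* The blocks are indexed by the rows and columns of [f p], so that
   [1 - linX N] is mapped to a companion matrix of blocks. *)
Definition rep_mx (M : 'M[A]_n.+1) : 'M[B]_(m * n.+1) :=
  flat (\matrix_(u, v) map_mx (fun p => f p u v) M).

Lemma rep_mxE M u i v j : rep_mx M (bidx u i) (bidx v j) = f (M i j) u v.
Proof. by rewrite flatE !mxE. Qed.

Lemma rep_mxM M N : rep_mx (M *m N) = rep_mx M *m rep_mx N.
Proof.
rewrite /rep_mx -flatM; congr flat; apply/matrixP => u v; apply/matrixP => i j.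
transitivity (\sum_l \sum_w f (M i l) u w * f (N l j) w v).
  rewrite !mxE rmorph_sum summxE; apply: eq_bigr => l _.
  by rewrite rmorphM mxE.
rewrite exchange_big [in RHS]mxE summxE; apply: eq_bigr => w _.
by rewrite !mxE; apply: eq_bigr => l _; rewrite !mxE.
Qed.

Lemma rep_mxD M N : rep_mx (M + N) = rep_mx M + rep_mx N.
Proof.
apply/matrixP; elim/bidx_ind => u i; elim/bidx_ind => v j.
by rewrite rep_mxE [RHS]mxE !rep_mxE mxE rmorphD mxE.
Qed.

Lemma rep_mx1 : rep_mx 1%:M = 1%:M.
Proof.
rewrite -(flat1 B m n); congr flat; apply/matrixP => u v.
apply/matrixP => i j; rewrite !mxE rmorph_nat.
by case ij: (i == j); rewrite !mxE; case uv: (u == v); rewrite !mxE ?uv ?ij.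
Qed.

Definition rep_GL (x : GLn A n.+1) : GLn B (m * n.+1).
Proof.
refine (@mkGL _ _ (rep_mx (glmx x)) (rep_mx (glmx x^-1%g)) _ _).
  by rewrite -rep_mxM -glmxM mulgV rep_mx1.
by rewrite -rep_mxM -glmxM mulVg rep_mx1.
Defined.

Lemma rep_GLM x y : rep_GL (x * y)%g = (rep_GL x * rep_GL y)%g.
Proof. by apply: glmx_inj; rewrite glmxM -rep_mxM. Qed.

Lemma rep_GL1 : rep_GL 1%g = 1%g.
Proof. by apply: glmx_inj; exact: rep_mx1. Qed.

Lemma rep_GLV x : rep_GL x^-1%g = (rep_GL x)^-1%g.
Proof. by apply: (@mulgI _ (rep_GL x)); rewrite -rep_GLM !mulgV rep_GL1. Qed.

Lemma En_rep x : En A n.+1 x -> En B (m * n.+1) (rep_GL x).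
Proof.
elim=> {x} [x [i [j [a [ij xE]]]]||x y _ IHx _ IHy|x _ IHx].
(* The image of 1 + a e_ij differs from 1 only in rows with remainder i and columns with remainder
   j, and i != j. *)
- have [|y Ey yE] := @En_support B _ [pred k | brem k == i]
      (rep_mx (a *: delta_mx i j)).
    elim/bidx_ind => u k; elim/bidx_ind => v l; rewrite /= !bremK rep_mxE !mxE.
    have [_|] := eqVneq k i; last by rewrite mulr0 rmorph0 mxE.
    have [->|] := eqVneq l j; last by rewrite mulr0 rmorph0 mxE.
    by rewrite eq_sym ij.
  suff -> : rep_GL x = y by [].
  by apply: glmx_inj; rewrite yE /glmx /= xE rep_mxD rep_mx1.
- by rewrite rep_GL1; exact: gen1.
- by rewrite rep_GLM; exact: genM.
- by rewrite rep_GLV; exact: genV.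
Qed.

End MatrixRepresentation.

(** * Classes in K_1 and matrices linear in X *)

Section StableClass.
Variable A : pzRingType.

Lemma GLresizeX n N (h : (n <= N)%N) (x : GLn A n) k :
  GLresize h (x ^+ k)%g = (GLresize h x ^+ k)%g.
Proof. by elim: k => [|k IH]; rewrite ?GLresize1 // !expgS GLresizeM IH. Qed.

Definition stable_class n (x : GLn A n) : K1 A := inK1 (inGL x).

Lemma stable_classM n (x y : GLn A n) :
  stable_class (x * y)%g = (stable_class x * stable_class y)%g.
Proof. by rewrite /stable_class inGLM inK1M. Qed.

Lemma stable_class1 n : stable_class (1%g : GLn A n) = 1%g.
Proof. by rewrite /stable_class inGL1. Qed.

Lemma stable_classX n (x : GLn A n) k :
  stable_class (x ^+ k)%g = (stable_class x ^+ k)%g.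
Proof. by elim: k => [|k IH]; rewrite ?stable_class1 // !expgS stable_classM IH. Qed.

Lemma stable_classV n (x : GLn A n) :
  stable_class x^-1%g = (stable_class x)^-1%g.
Proof. by rewrite /stable_class inGLV inK1V. Qed.

Lemma stable_class_resize n N (h : (n <= N)%N) (x : GLn A n) :
  stable_class (GLresize h x) = stable_class x.
Proof. by rewrite /stable_class inGL_resize. Qed.

Lemma inK1_E (p : GL A) : inK1 p = 1%g <-> E p.
Proof.
split=> [/esym/inK1_eq|Ep]; first by rewrite invg1 mul1g.
by apply/esym/inK1_eq; rewrite invg1 mul1g.
Qed.

Lemma stable_class_En n (x : GLn A n) : En A n x -> stable_class x = 1%g.
Proof. by move=> Ex; apply/inK1_E; exists n, x. Qed.

End StableClass.

Section LinearMatrices.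
Variable R : nzRingType.

Definition linX n (N : 'M[R]_n) : 'M[{poly R}]_n :=
  \matrix_(i, j) (N i j *: 'X).

Lemma linX_scalar_comm n (N : 'M[R]_n.+1) (a : R) :
  (forall r, GRing.comm a r) -> GRing.comm (linX N) (a%:P)%:M.
Proof.
move=> a_central; rewrite /GRing.comm (mul_scalar_mx _ _ : (a%:P)%:M * _ = _).
apply/matrixP => i j; rewrite !mxE (bigD1 j) //= big1 ?addr0.
  by rewrite !mxE eqxx mulr1n -!mul_polyC -mulrA -(commr_polyX a%:P) !mulrA -!polyCM a_central.
by move=> l lj; rewrite !mxE (negPf lj) mulr0.
Qed.

End LinearMatrices.

(** * The transfer of the class of 1 - NX *)

Section Transfer.
Variables (R : nzRingType) (m : nat) (a : R).
Hypothesis a_central : forall r, GRing.comm a r.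

(** Centrality of a makes the diagonal scalars from R commute with the entries of C, as
    [horner_morph] requires. *)
Fact companion_comm :
  commr_rmorph (@scalar_mx {poly R} m.+1 \o polyC) (companion m 'X a%:P).
Proof.
move=> r; apply/matrixP => u v; rewrite !mxE /=.
rewrite (bigD1 v) //= big1 ?addr0 => [|w wv]; last first.
  by rewrite !mxE (negPf wv) mulr0.
rewrite (bigD1 u) //= big1 ?addr0 => [|w wv]; last first.
  by rewrite !mxE [u == w]eq_sym (negPf wv) mul0r.
rewrite !mxE !eqxx !mulr1n.
have cX : GRing.comm r%:P ('X : {poly R}) by exact: commr_polyX.
have ca : GRing.comm r%:P (a%:P : {poly R}).
  by rewrite /GRing.comm -!polyCM a_central.
apply: commr_sym; apply: commrD; apply: commrM => //; try exact: commr_nat.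
exact: commrM.
Qed.

Definition transfer : {rmorphism {poly R} -> 'M[{poly R}]_m.+1} :=
  horner_morph companion_comm.

(** Regrouping the products N_ij C_uv by (u, v) gives the blocks of the companion matrix at b = NX;
    a moves past N_ij by centrality. *)
Lemma transfer_linear n (N : 'M[R]_n.+1) :
  rep_mx transfer (1%:M - linX N) =
  flat (1%:M - companion m (linX N) (a%:P)%:M).
Proof.
apply/matrixP; elim/bidx_ind => u i; elim/bidx_ind => v j.
transitivity (((i == j) && (u == v))%:R
              - (N i j)%:P * companion m 'X (a%:P : {poly R}) u v).
  rewrite rep_mxE !mxE rmorphB rmorph_nat -mul_polyC rmorphM /=.
  rewrite horner_morphC horner_morphX mxE; congr (_ + _).
    by case: (i == j); rewrite /= ?mulr0n !mxE.
  by rewrite mxE /= -[_ * companion _ _ _]/(_%:M *m _) mul_scalar_mx !mxE.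
rewrite flatE !(mxE, mulr_natl, mulmxnE); congr (_ - _).
  by rewrite -mulrnA mulnb.
rewrite (bigD1 i) //= big1 ?addr0 => [|l li]; last first.
  by rewrite !mxE eq_sym (negPf li) mul0r.
rewrite !mxE eqxx mulr1n mulrDr !mulrnAr mul_polyC; congr (_ + _ *+ _).
by rewrite -mul_polyC !mulrA -!polyCM a_central.
Qed.

(** By [companion_factorization] the image of 1 - NX is diag(1 - a (NX)^(m+1), 1, ..., 1) between
    two products of elementary matrices. *)
Lemma transfer_class n (N : 'M[R]_n.+1) (x y : GLn {poly R} n.+1) :
  glmx x = 1%:M - linX N ->
  glmx y = 1%:M - (a%:P)%:M * linX N ^+ m.+1 ->
  stable_class (rep_GL transfer x) = stable_class y.
Proof.
move=> xE yE.
set b := linX N in xE yE *; pose c : 'M[{poly R}]_n.+1 := (a%:P)%:M.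
have bc : GRing.comm b c by exact: linX_scalar_comm.
have shiftE t : exists2 z : GLn {poly R} (m.+1 * n.+1), En _ _ z
   & glmx z = flat (1%:M - shift m b (ltn^~ t)).
  elim: t => [|t [z Ez zE]].
    exists 1%g; first exact: gen1.
    suff -> : shift m b (ltn^~ 0) = 0 by rewrite subr0 flat1.
    by apply/matrixP => u v; rewrite !mxE /= mul0r.
  have [|y' Ey' y'E] := @En_flat {poly R} m.+1 n (pred1 t \o val) (- shift m b (pred1 t)).
    move=> u v /=; rewrite !mxE /=; case: eqP => [->|] /=; last by rewrite mul0r oppr0.
    by case: (t.+1 =P v) => [<-|_ _]; [rewrite gtn_eqF | rewrite mul0r oppr0].
  exists (y' * z)%g; first exact: genM.
  by rewrite glmxM y'E zE -flatM shiftS.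
have [z1 Ez1 z1E] := shiftE m.
have [|z2 Ez2 z2E] := @En_flat {poly R} m.+1 n (leq 1 \o val) (- column m b c (leq 1)).
  move=> u v /=; rewrite !mxE /=.
  case: (val u) => [|u'] /=; first by rewrite mul0r oppr0.
  by case: (val v) => [|v'] //=; rewrite mul0r oppr0.
have nm : (n.+1 <= m.+1 * n.+1)%N by rewrite mulSn leq_addr.
(* The corner factor is the stabilization of [y], since block (0, 0) occupies the first indices. *)
have dE : glmx (GLresize nm y) = flat (1%:M - corner m b c).
  apply/matrixP; elim/bidx_ind => u i; elim/bidx_ind => v j.
  have insubE (w : 'I_m.+1) (l : 'I_n.+1) :
      insub (w * n.+1 + l)%N = if w == 0 :> nat then Some l else None.
    case: eqP => [->|/eqP w0]; first by rewrite mul0n add0n valK.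
    by rewrite insubF // ltnNge (leq_trans _ (leq_addr _ _)) // leq_pmull // lt0n.
  have blockE : (1%:M - corner m b c) u v =
      1%:M u v - ((u == 0 :> nat) && (v == 0 :> nat))%:R * (c * b ^+ m.+1).
    by rewrite !mxE.
  have oneE : (1%:M : 'M['M[{poly R}]_n.+1]_m.+1) u v i j =
      (u * n.+1 + i == v * n.+1 + j)%N%:R.
    by rewrite -flatE flat1 mxE -val_eqE.
  rewrite flatE mxE /stab /= !insubE blockE.
  case: eqP => [u0|_] /=; last by rewrite mul0r subr0 oneE.
  case: eqP => [v0|_] /=; last by rewrite mul0r subr0 oneE.
  have uv : u = v by apply: val_inj; exact: etrans u0 (esym v0).
  by rewrite yE mul1r uv [1%:M v v]mxE eqxx.
have -> : rep_GL transfer x = (z1 * GLresize nm y * z2)%g.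
  apply: glmx_inj; rewrite !glmxM z1E z2E dE -!flatM companion_factorization //.
  by rewrite /glmx /= -/(glmx x) xE transfer_linear.
rewrite !stable_classM stable_class_resize (stable_class_En Ez1).
by rewrite (stable_class_En Ez2) mul1g mulg1.
Qed.

End Transfer.

(** * Descending induction along powers of NX *)

Section TruncatedSeries.
Variables (S : comNzRingType) (m : nat).

Definition leading (c : S) (q : {poly S}) :=
  exists h, q = 1 + c%:P * 'X^(m.+1) + 'X^(m.+2) * h.

(** The coefficients add because the cross term c d X^(2m+2) is divisible by X^(m+2). *)
Lemma leadingM c d p q : leading c p -> leading d q -> leading (c + d) (p * q).
Proof.
move=> [f ->] [g ->]; exists (f * (1 + d%:P * 'X^(m.+1) + 'X^(m.+2) * g)
  + g * (1 + c%:P * 'X^(m.+1)) + c%:P * d%:P * 'X^m).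
by rewrite polyCD !exprS; ring.
Qed.

Lemma leadingX c q k : leading c q -> leading (c *+ k) (q ^+ k).
Proof.
move=> hq; elim: k => [|k IH]; last by rewrite mulrS exprS; apply: leadingM.
by exists 0; rewrite mul0r mulr0 !addr0.
Qed.

(** A truncated inverse of 1 - c X^(m+1); with [s.+2] terms, the one linear in c is present for
    every s. *)
Lemma leading_geometric c s :
  leading c (\sum_(i < s.+2) (c%:P * 'X^(m.+1)) ^+ i).
Proof.
rewrite !big_ord_recl /= expr0 expr1 addrA.
exists (c%:P ^+ 2 * 'X^m * \sum_(i < s) (c%:P * 'X^(m.+1)) ^+ i).
congr (_ + _); rewrite mulrA mulr_sumr; apply: eq_bigr => i _.
by rewrite /bump /= !add1n !exprS; ring.
Qed.

End TruncatedSeries.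

Section CoefficientRing.
Variables (R S : nzRingType) (n : nat) (N : 'M[R]_n.+1).
Variable phi : {rmorphism S -> R}.
Hypothesis phi_central : forall c r, GRing.comm (phi c) r.

Fact linX_comm :
  commr_rmorph (@scalar_mx {poly R} n.+1 \o polyC \o phi) (linX N).
Proof. by move=> c; apply: linX_scalar_comm. Qed.

Definition eval_linX : {rmorphism {poly S} -> 'M[{poly R}]_n.+1} :=
  horner_morph linX_comm.

Lemma eval_linX_monomial c m :
  eval_linX (c%:P * 'X^m) = ((phi c)%:P)%:M * linX N ^+ m.
Proof. by rewrite rmorphM rmorphXn /= horner_morphC horner_morphX. Qed.

End CoefficientRing.

Section Torsion.
Variables (R : nzRingType) (n k : nat) (N : 'M[R]_n.+1) (x : GLn {poly R} n.+1).
Hypothesis xE : glmx x = 1%:M - linX N.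
Hypothesis Exk : En {poly R} n.+1 (x ^+ k)%g.

(** [rep_GL] is multiplicative and preserves elementary products, so the k-th power of the image of
    x is elementary as well. *)
Lemma torsion_transfer (m : nat) (a : R) (a_central : forall r, GRing.comm a r)
    (y : GLn {poly R} n.+1) :
  glmx y = 1%:M - (a%:P)%:M * linX N ^+ m.+1 -> (stable_class y ^+ k)%g = 1%g.
Proof.
move=> yE; rewrite -(transfer_class a_central xE yE) -stable_classX.
have -> : (rep_GL (transfer m a_central) x ^+ k = rep_GL (transfer m a_central) (x ^+ k))%g.
  by elim: k => [|l IH]; rewrite ?rep_GL1 // !expgS rep_GLM IH.
exact/stable_class_En/En_rep.
Qed.

Variables (s : nat) (S : comNzRingType) (phi : {rmorphism S -> R}) (kappa : S).
Hypothesis Ns : linX N ^+ s = 0.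
Hypothesis phi_central : forall c r, GRing.comm (phi c) r.
(* In the application [S] is Z[t], with t |-> 1/k; power series manipulations then
   take place over a commutative ring. *)
Hypothesis phi_kappa : phi (kappa *+ k) = 1.

Let ev := eval_linX N phi_central.

(** Induction on d, a bound on the number of nonzero powers of NX from m + 1 on. Dividing y by the
    k-th power of 1 - (c/k) (NX)^(m+1), with c the constant coefficient of g, raises m by one. *)
Lemma unipotent_class d m (g : {poly S}) (y : GLn {poly R} n.+1) :
  (s <= m.+1 + d)%N -> glmx y = ev (1 - 'X^(m.+1) * g) -> stable_class y = 1%g.
Proof.
elim: d m g y => [|d IH] m g y sm yE.
  suff -> : y = 1%g by exact: stable_class1.
  apply: glmx_inj; rewrite yE rmorphB rmorphM rmorph1 -['X^_]mul1r eval_linX_monomial.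
  rewrite addn0 in sm.
  by rewrite -(subnKC sm) exprD Ns mul0r mulr0 mul0r subr0.
(* Only the splitting of g into g X + c is used; g = 0 passes directly to m + 1. *)
move: yE; elim/poly_ind: g => [|g c _] yE.
  apply: (IH m.+1 0); first by rewrite addSnnS.
  by rewrite yE !mulr0.
(* [e] stands for c/k, and [q] evaluates to the inverse of 1 - w because w^(s+2) evaluates to 0. *)
pose e := kappa * c; pose w := e%:P * 'X^(m.+1).
pose q := \sum_(i < s.+2) w ^+ i.
have ws : ev (w ^+ s.+2) = 0.
  have sm2 : (s <= m.+1 * s.+2)%N by rewrite mulSn -addn2 -!addnA leq_addr.
  rewrite exprMn -exprM -polyC_exp eval_linX_monomial.
  by rewrite -(subnKC sm2) exprD Ns mul0r mulr0.
have wq : ev (1 - w) *m ev q = 1%:M.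
  rewrite -[LHS]rmorphM -opprB mulNr -subrX1 opprB rmorphB rmorph1 ws.
  exact: subr0.
have qw : ev q *m ev (1 - w) = 1%:M.
  by rewrite -[LHS]rmorphM mulrC rmorphM.
pose z := mkGL wq qw.
have zk : (stable_class z ^+ k)%g = 1%g.
  apply: (torsion_transfer (phi_central e)) => //.
  by rewrite /glmx /= rmorphB rmorph1 eval_linX_monomial.
have -> : (y = z ^+ k * (z^-1 ^+ k * y))%g by rewrite mulgA expVgn mulgV mul1g.
rewrite stable_classM stable_classX zk mul1g.
(* The factor q^k contributes k e and y contributes -c; the sum vanishes after applying [phi]. *)
have [h hE] : leading m (e *+ k - c) (q ^+ k * (1 - 'X^(m.+1) * (g * 'X + c%:P))).
  apply: leadingM; first exact/leadingX/leading_geometric.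
  by exists (- g); rewrite polyCN !exprS; ring.
apply: (IH m.+1 (- h)); first by rewrite addSnnS.
have zVk : glmx (z^-1 ^+ k)%g = ev q ^+ k.
  by elim: k => [|l IHl] //; rewrite expgS exprS glmxM IHl.
rewrite glmxM zVk yE -rmorphXn -[LHS]rmorphM hE mulrN opprK.
have kc : phi (e *+ k - c) = 0.
  by rewrite /e -mulrnAl rmorphB rmorphM phi_kappa mul1r subrr.
rewrite [1 + _ + _]addrAC [LHS]rmorphD eval_linX_monomial kc.
by rewrite polyC0 raddf0 mul0r addr0.
Qed.

Lemma linear_class : stable_class x = 1%g.
Proof.
apply: (@unipotent_class s 0 1); first by rewrite leq_addl.
by rewrite mulr1 rmorphB rmorph1 xE /= horner_morphX.
Qed.

End Torsion.

(** * Higman linearization *)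

Section HigmanLinearization.
Variable R : nzRingType.

(* [1, X; 0, 1] [B + XC, 0; 0, 1] [1, 0; -C, 1] = [B, X; -C, 1]. *)
Lemma higman_step d n (x : GLn {poly R} n) :
  (forall i j, (size (glmx x i j) <= d.+3)%N) ->
  exists2 y : GLn {poly R} (n + n), stable_class y = stable_class x
    & forall i j, (size (glmx y i j) <= d.+2)%N.
Proof.
(* The matrix of x is B + XC with B constant, and C has smaller degree. The new entry X has size 2,
   where the reduction stops. *)
move=> xd; pose C : 'M[{poly R}]_n := map_mx (drop_poly 1) (glmx x).
exists (up 'X%:M * GLresize (leq_addr n n) x * low (- C))%g.
  rewrite !stable_classM stable_class_resize (stable_class_En (En_up _)).
  by rewrite (stable_class_En (En_low _)) mul1g mulg1.
have -> : glmx (up 'X%:M * GLresize (leq_addr n n) x * low (- C))%g =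
    block_mx (map_mx (take_poly 1) (glmx x)) 'X%:M (- C) 1%:M.
  rewrite !glmxM [glmx (GLresize _ _)]resizeE /glmx /= -/(glmx x).
  rewrite !mulmx_block !mul0mx !mulmx0 !mul1mx !mulmx1 ?addr0 ?add0r.
  congr block_mx; rewrite mulmxN mul_scalar_mx ?scale1r //.
  apply/matrixP => i j; rewrite !mxE.
  by rewrite -[X in X - _](poly_take_drop 1) expr1 -commr_polyX addrK.
move=> i j; case: (split_ordP i) => i' ->; case: (split_ordP j) => j' ->;
  rewrite ?block_mxEul ?block_mxEur ?block_mxEdl ?block_mxEdr !mxE.
- exact: leq_trans (size_take_poly _ _) _.
- by case: eqP => _; rewrite ?mulr1n ?mulr0n ?size_polyX ?size_poly0.
- by rewrite size_polyN size_drop_poly leq_subLR.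
- by case: eqP => _; rewrite ?mulr1n ?mulr0n ?size_poly1 ?size_poly0.
Qed.

Lemma size_entries m n (M : 'M[{poly R}]_(m, n)) :
  exists s, forall i j, (size (M i j) <= s)%N.
Proof.
exists (\max_i \max_j size (M i j)) => i j.
by apply: (bigmax_sup i) => //; apply: leq_bigmax.
Qed.

Lemma higman_linear n (x : GLn {poly R} n.+1) :
  exists n', exists2 y : GLn {poly R} n'.+1, stable_class y = stable_class x
    & forall i j, (size (glmx y i j) <= 2)%N.
Proof.
have [d xd] := size_entries (glmx x).
have {}xd i j : (size (glmx x i j) <= d.+2)%N by rewrite (leq_trans (xd i j)) // ltnW.
elim: d n x xd => [|d IH] n x xd; first by exists n, x.
have [y <- yd] := higman_step xd.
(* The doubled size n.+1 + n.+1 is convertible to (n + n.+1).+1. *)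
exact: (IH (n + n.+1)%N y yd).
Qed.

(** After linearization y = y(0) + A1 X, and y is multiplied by the inverse of y(0). The class of
    y(0) over R[X] comes from its class over R, trivial by hypothesis. *)
Lemma linear_representative n (x : GLn {poly R} n) :
  K1_map (ev0 (R := R)) (stable_class x) = 1%g ->
  exists n' (N : 'M[R]_n'.+1), exists2 y : GLn {poly R} n'.+1,
    stable_class y = stable_class x & glmx y = 1%:M - linX N.
Proof.
rewrite -(stable_class_resize (leqnSn n)) => x0.
have [n' [y yx ys]] := higman_linear (GLresize (leqnSn n) x).
exists n'; pose y0 := GLn_map (ev0 (R := R)) y.
pose A1 : 'M[R]_n'.+1 := map_mx (fun p : {poly R} => p`_1) (glmx y).
exists (- (glmx y0^-1%g *m A1)).
exists (GLn_map polyC y0^-1%g * y)%g.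
  rewrite stable_classM yx -[RHS]mul1g; congr (_ * _)%g; rewrite GLn_mapV stable_classV.
  suff -> : stable_class (GLn_map polyC y0) = 1%g by rewrite invg1.
  apply/inK1_E; rewrite -GL_mapE; apply: E_map; apply/inK1_E.
  by rewrite -GL_mapE -K1_mapE -x0 -yx.
have yE : glmx y = map_mx polyC (glmx y0) + linX A1.
  rewrite (_ : glmx y0 = map_mx (ev0 (R := R)) (glmx y)) //.
  apply/matrixP => i j; rewrite !mxE /ev0 horner_coef0; apply/polyP => t.
  rewrite !coefE; case: t => [|[|t]]; rewrite ?mulr0 ?mulr1 ?addr0 ?add0r //.
  by rewrite nth_default // (leq_trans (ys i j)).
rewrite glmxM yE mulmxDr -map_mxM -glmxM mulVg map_mx1; congr (_ + _).
apply/matrixP => i j; rewrite !mxE scaleNr opprK scaler_suml.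
by apply: eq_bigr => l _; rewrite !mxE -!mul_polyC mulrA -polyCM.
Qed.

(** Since D = 1 + NX D, the matrix D is the geometric series in NX. *)
Lemma linX_coef n (N : 'M[R]_n.+1) (D : 'M[{poly R}]_n.+1) :
  (1%:M - linX N) *m D = 1%:M -> forall t i j, (D i j)`_t = (N ^+ t) i j.
Proof.
rewrite mulmxBl mul1mx => /eqP; rewrite subr_eq => /eqP DE t.
have De i j : D i j = (i == j)%:R + 'X * \sum_l (N i l)%:P * D l j.
  rewrite [in LHS]DE !mxE; congr (_ + _); rewrite mulr_sumr; apply: eq_bigr => l _.
  by rewrite mxE mulrA -commr_polyX mul_polyC.
elim: t => [|t IH] i j; rewrite De coefD coefXM -polyC_natr coefC /=.
  by rewrite addr0 mxE.
rewrite add0r coef_sum exprS mxE; apply: eq_bigr => l _.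
by rewrite coefCM IH.
Qed.

(** The inverse of 1 - NX has polynomial entries of bounded degree, so its coefficients N^t vanish
    for large t. *)
Lemma linX_nilpotent n (N : 'M[R]_n.+1) (y : GLn {poly R} n.+1) :
  glmx y = 1%:M - linX N -> exists s, linX N ^+ s = 0.
Proof.
move=> yE; have [s ys] := size_entries (glmx y^-1%g).
have NE : N ^+ s = 0.
  apply/matrixP => i j; rewrite -(linX_coef (D := glmx y^-1%g)).
    by rewrite mxE nth_default.
  by rewrite -yE -glmxM mulgV.
have linXX t : linX N ^+ t = map_mx (fun r => r *: 'X^t) (N ^+ t).
  elim: t => [|t IH]; first by apply/matrixP => i j; rewrite !mxE alg_polyC polyC_natr.
  apply/matrixP => i j; rewrite !exprS IH !mxE scaler_suml.
  apply: eq_bigr => l _; rewrite !mxE -!mul_polyC -mulrA (mulrA 'X).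
  by rewrite -(commr_polyX (_ l j)%:P) -!mulrA mulrA polyCM.
exists s; rewrite linXX NE.
by apply/matrixP => i j; rewrite !mxE scale0r.
Qed.

Lemma resize_linX n k (N : 'M[R]_n) :
  resize (n + k) (1%:M - linX N) = 1%:M - linX (block_mx N 0 0 0 : 'M_(n + k)).
Proof.
have -> : linX (block_mx N 0 0 0 : 'M_(n + k)) = block_mx (linX N) 0 0 0.
  apply/matrixP => i j; rewrite [LHS]mxE.
  case: (split_ordP i) => i' ->; case: (split_ordP j) => j' ->;
    rewrite ?block_mxEul ?block_mxEur ?block_mxEdl ?block_mxEdr !mxE ?scale0r //.
by rewrite resizeE scalar_mx_block opp_block_mx add_block_mx !oppr0 !addr0.
Qed.

End HigmanLinearization.

(** * Absence of k-torsion in NK_1(R) *)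

Lemma central_inverse_nat (R : nzRingType) (k : nat) (u : R) :
  u * k%:R = 1 -> k%:R * u = 1 -> forall r, GRing.comm u r.
Proof.
move=> uk ku r; rewrite /GRing.comm -[RHS]mul1r -uk -!mulrA; congr (_ * _).
by rewrite mulrA -(commr_nat r k) -mulrA ku mulr1.
Qed.

Theorem theorem1p1 (R : nzRingType) (k : nat) (k_gt0 : (0 < k)%N)
    (k_unit : exists u : R, u * k%:R = 1 /\ k%:R * u = 1) :
  forall x : NK1 R, (x ^+ k = 1)%g -> x = 1%g.
Proof.
move=> x xk; have [u [uk ku]] := k_unit.
have u_central := central_inverse_nat uk ku.
have {}xk : (nk1val x ^+ k = 1)%g by rewrite -[RHS](congr1 val xk) gmulfXn.
have /eqP x0 : K1_map (ev0 (R := R)) (nk1val x) == 1%g by case: (x).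
apply: val_inj; rewrite gmulf1 /=.
move: (nk1val x) x0 xk; elim/K1_ind1; elim/GL_ind1 => n y.
rewrite -/(stable_class y) => /linear_representative [n' [N [z <- zE]]].
(* The class of z^k is that of an elementary [w] of another size. At a common size the k-th power of
   the stabilized z is itself elementary, as the transfer argument demands. *)
rewrite -stable_classX => /inK1_E [n2 [w [Ew zw]]].
pose le1 : (n'.+1 <= (n' + n2).+1)%N := leq_addr n2 n'.+1.
pose le2 : (n2 <= (n' + n2).+1)%N := leq_addl n'.+1 n2.
pose z' := GLresize le1 z.
have Ez : En {poly R} (n' + n2).+1 (z' ^+ k)%g.
  by rewrite -GLresizeX (inGL_resize_eq le1 le2 zw); exact: En_resize.
have z'E : glmx z' = 1%:M - linX (block_mx N 0 0 0 : 'M_(n'.+1 + n2)).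
  by rewrite -resize_linX -zE.
have [s Ns] := linX_nilpotent z'E.
(* ['X] goes to the inverse u of k and serves as [kappa]; u and the integers are central, hence so
   is the whole image. *)
pose phi : {rmorphism {poly int} -> R} := horner_morph (commr_int u : commr_rmorph intr u).
have phi_central c r : GRing.comm (phi c) r.
  apply: commr_sym; elim/poly_ind: c => [|p c IH]; first by rewrite rmorph0; exact: commr0.
  rewrite rmorphD rmorphM /= horner_morphX horner_morphC.
  apply: commrD; last exact: commr_int.
  by apply: commrM => //; apply: commr_sym.
rewrite -(stable_class_resize le1).
apply: (linear_class z'E Ez (phi := phi) (kappa := 'X) Ns phi_central).
by rewrite rmorphMn /= horner_morphX -mulr_natr uk.
Qed.
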